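(* Let a hierarchy with root $0$ and set of non-root nodes $\mathcal{A}=\{1,\dots,N_L\}$ be given, together with nonzero vectors $\mathbf{a}^{(i)}\in\mathbb{R}^d$ for $i\in\mathcal{A}$ and half-angles $\theta_1,\dots,\theta_L\ge 0$. Suppose that the following two conditions hold. 1. (Subtree containment) For every $i\in\mathcal{A}$ and every $j\in\mathrm{desc}(i)$, $$\angle(\mathbf{a}^{(i)},\mathbf{a}^{(j)})\le\theta_{\mathrm{lev}(i)} .$$ 2. (Sibling-cone disjointness) For every node $i$ (including the root) and every pair of distinct children $j,j'\in\mathrm{chi}(i)$, $$\angle(\mathbf{a}^{(j)},\mathbf{a}^{(j')})>\theta_{\mathrm{lev}(j)}+\theta_{\mathrm{lev}(j')} .$$ Then for any two distinct children $j,j'$ of a common node, the subtrees $\{j\}\cup\mathrm{desc}(j)$ and $\{j'\}\cup\mathrm{desc}(j')$ are disjoint, and every non-root node has a unique parent.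
   Context: A hierarchy is a finite directed acyclic graph with edges directed from parent to child, having a distinguished root node $0$ from which every other node is reachable by a directed path; every node that has at least one child (internal node) has exactly $b$ children. For a node $i$, $\mathrm{chi}(i)$ is the set of its children, $\mathrm{desc}(i)$ is the set of its descendants (nodes $j\neq i$ reachable from $i$ by a directed path), $\mathrm{anc}(i)$ is the set of its ancestors (nodes $j\ne i$ from which $i$ is reachable), and $\mathrm{lev}(i)=|\mathrm{anc}(i)|$ is its level. $L$ is the largest level. Siblings are distinct children of a common node. For nonzero vectors $u,v\in\mathbb{R}^d$, $\angle(u,v)=\arccos\frac{\langle u,v\rangle}{\|u\|\,\|v\|}\in[0,\pi]$. For a leaf node, $\mathrm{desc}(i)=\emptyset$ and condition 1 is vacuous. *)

(* Defs.v *)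
From mathcomp Require Import all_boot all_order all_algebra.
From mathcomp Require Import reals trigo.

Set Implicit Arguments.
Unset Strict Implicit.
Unset Printing Implicit Defensive.

Import Order.TTheory GRing.Theory Num.Theory.
Local Open Scope ring_scope.

Section Digraph.
Variables (T : finType) (e : rel T).

Definition chi (i : T) : {set T} := [set j | e i j].

(* [connect e] is the reflexive-transitive closure of [e]. *)
Definition desc (i : T) : {set T} := [set j | (j != i) && connect e i j].

Definition anc (i : T) : {set T} := [set j | (j != i) && connect e j i].

Definition lev (i : T) : nat := #|anc i|.

Definition max_lev : nat := (\max_(i : T) lev i)%N.

(* [cycle e c] also holds of the empty sequence; loops are the cycles of
   length 1. *)
Definition acyclic : Prop := forall c : seq T, c != [::] -> ~~ cycle e c.

Record hierarchy (b : nat) (root : T) : Prop := Hierarchy {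
  hierarchy_acyclic : acyclic;
  hierarchy_reachable : forall i : T, i != root -> connect e root i;
  hierarchy_branching : forall i : T, chi i != set0 -> #|chi i| = b
}.

End Digraph.

Section Angle.
Variables (R : realType) (d : nat).
Implicit Types u v : 'rV[R]_d.

Definition dot u v : R := \sum_(k < d) u 0 k * v 0 k.

(* The library norm on ['rV[R]_d] is the sup norm, hence this definition. *)
Definition norm2 u : R := Num.sqrt (dot u u).

Definition angle u v : R := acos (dot u v / (norm2 u * norm2 v)).

End Angle.

(* Main.v *)
(** The angle is a metric on the unit sphere, so two sibling cones whose axes
    are further apart than the sum of their half-angles cannot share a vector,
    and hence the subtrees they contain cannot share a node.  Two different
    paths from the root to the same node would have to diverge at some node
    into two distinct siblings whose subtrees both contain the endpoint; so
    every node is reached by a single path, whose last edge gives the unique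
    parent. *)

Require Import Defs.
From mathcomp Require Import all_boot all_order all_algebra.
From mathcomp Require Import reals trigo.
From mathcomp Require Import ring.

Set Implicit Arguments.
Unset Strict Implicit.
Unset Printing Implicit Defensive.

Import Order.TTheory GRing.Theory Num.Theory.
Local Open Scope ring_scope.

Section AngleTheory.
Variables (R : realType) (d : nat).
Implicit Types (u v w : 'rV[R]_d) (x y z : R).

Lemma dotC u v : dot u v = dot v u.
Proof. by apply: eq_bigr => k _; rewrite mulrC. Qed.

Lemma dotBl u v w : dot (u - v) w = dot u w - dot v w.
Proof. by rewrite /dot -sumrB; apply: eq_bigr => k _; rewrite !mxE mulrBl. Qed.

Lemma dotZl x u v : dot (x *: u) v = x * dot u v.
Proof. by rewrite /dot mulr_sumr; apply: eq_bigr => k _; rewrite !mxE mulrA. Qed.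

Lemma dotBr u v w : dot u (v - w) = dot u v - dot u w.
Proof. by rewrite dotC dotBl !(dotC u). Qed.

Lemma dotZr x u v : dot u (x *: v) = x * dot u v.
Proof. by rewrite dotC dotZl dotC. Qed.

Lemma dot_ge0 u : 0 <= dot u u.
Proof. by apply: sumr_ge0 => k _; rewrite -expr2 sqr_ge0. Qed.

Lemma dot_eq0 u : (dot u u == 0) = (u == 0).
Proof.
apply/idP/eqP => [|->]; last by rewrite /dot big1 // => k _; rewrite mxE mul0r.
rewrite psumr_eq0 => [/allP u0|k _]; last by rewrite -expr2 sqr_ge0.
apply/rowP => k; rewrite mxE; apply/eqP.
by have := u0 k (mem_index_enum k); rewrite -expr2 sqrf_eq0.
Qed.

Lemma dot_cauchy_schwarz u v : dot u v ^+ 2 <= dot u u * dot v v.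
Proof.
have [->|v_neq0] := eqVneq v 0.
  have dot0 w : dot w 0 = 0 by rewrite -(scale0r 0) dotZr mul0r.
  by rewrite !dot0 expr0n mulr0.
have vv_gt0 : 0 < dot v v by rewrite lt_neqAle eq_sym dot_eq0 v_neq0 dot_ge0.
rewrite -subr_ge0 -(pmulr_rge0 _ vv_gt0).
(* The squared length of this multiple of the component of [u] orthogonal to [v] is exactly
   [dot v v] times the gap in the inequality. *)
have := dot_ge0 (dot v v *: u - dot u v *: v).
rewrite !(dotBl, dotBr, dotZl, dotZr) (dotC v u).
by congr (_ <= _); ring.
Qed.

Definition unitv u : 'rV[R]_d := (norm2 u)^-1 *: u.

Lemma dot_unitv u v : dot (unitv u) (unitv v) = dot u v / (norm2 u * norm2 v).
Proof. by rewrite dotZl dotZr invfM mulrA mulrC. Qed.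

Lemma dot_unitv_id u : u != 0 -> dot (unitv u) (unitv u) = 1.
Proof.
move=> u0; rewrite dot_unitv -expr2 sqr_sqrtr ?dot_ge0// divff// dot_eq0//.
Qed.

Lemma angleE u v : angle u v = acos (dot (unitv u) (unitv v)).
Proof. by rewrite dot_unitv. Qed.

Lemma angleC u v : angle u v = angle v u.
Proof. by rewrite /angle dotC (mulrC (norm2 u)). Qed.

Lemma sqr_le1 x : (x ^+ 2 <= 1) = (-1 <= x <= 1).
Proof. by rewrite -ler_norml -(real_normK (num_real x)) expr_le1. Qed.

Lemma dot_unitv_bound u v : u != 0 -> v != 0 ->
  -1 <= dot (unitv u) (unitv v) <= 1.
Proof.
move=> u0 v0; have := dot_cauchy_schwarz (unitv u) (unitv v).
by rewrite !dot_unitv_id // mulr1 sqr_le1.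
Qed.

(* Cauchy-Schwarz for the components of [u] and [w] orthogonal to [v]. *)
Lemma dot_gram u v w : dot u u = 1 -> dot v v = 1 -> dot w w = 1 ->
  (dot u w - dot u v * dot v w) ^+ 2 <= (1 - dot u v ^+ 2) * (1 - dot v w ^+ 2).
Proof.
move=> uu vv ww.
have := dot_cauchy_schwarz (u - dot u v *: v) (w - dot v w *: v).
rewrite !(dotBl, dotBr, dotZl, dotZr) uu vv ww (dotC v u) (dotC w v).
by congr (_ <= _); ring.
Qed.

(** Since [cos] decreases on [[0, pi]], the claim becomes [x * y - sqrt ((1 - x ^+ 2) * (1 - y ^+
    2)) <= z] for the three cosines, which is the square root of [dot_gram]. *)
Lemma angle_triangle u v w : u != 0 -> v != 0 -> w != 0 ->
  angle u w <= angle u v + angle v w.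
Proof.
move=> u0 v0 w0; rewrite !angleE.
have xb := dot_unitv_bound u0 v0; have yb := dot_unitv_bound v0 w0.
have zb := dot_unitv_bound u0 w0.
have := dot_gram (dot_unitv_id u0) (dot_unitv_id v0) (dot_unitv_id w0).
move: xb yb zb.
set x := dot (unitv u) _; set y := dot (unitv v) _; set z := dot _ _.
move=> xb yb zb gram.
(* Comparing cosines is legitimate only while the sum stays in [[0, pi]]; beyond that, the bound
   [acos z <= pi] suffices. *)
have [pi_le|/ltW lt_pi] := leP pi (acos x + acos y).
  exact: le_trans (acos_lepi zb) pi_le.
have sum_in : acos x + acos y \in `[0, pi].
  by rewrite in_itv /= lt_pi addr_ge0 ?acos_ge0.
have z_in : acos z \in `[0, pi] by rewrite in_itv /= acos_ge0 ?acos_lepi.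
rewrite leNgt -ltr_cos // -leNgt cosD !acosK ?in_itv //= !sin_acos //.
rewrite -sqrtrM; last by rewrite subr_ge0 sqr_le1.
rewrite lerBlDr -lerBlDl (le_trans (ler_norm _)) // distrC -sqrtr_sqr.
exact: ler_wsqrtr.
Qed.

End AngleTheory.

Section DagTheory.
Variables (T : finType) (e : rel T).
Hypothesis dag : acyclic e.

Lemma acyclic_edge i j : e i j -> ~~ connect e j i.
Proof.
move=> eij; apply/negP => /connectP[s ps iE].
have /negP[] := dag (isT : j :: s != [::]).
by rewrite /= rcons_path ps -iE.
Qed.

Lemma in_subtree j k : (k \in j |: desc e j) = connect e j k.
Proof.
by rewrite !inE; case: eqVneq => [->|] //=; rewrite connect0.
Qed.

(** Induction on the first path, with [i] general. If only one path is empty, the other returns to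
    [i] and closes a cycle; if the first steps differ, the common endpoint lies in two sibling
    subtrees. *)
Lemma acyclic_path_uniq :
  (forall i j j', e i j -> e i j' -> j != j' ->
     [disjoint j |: desc e j & j' |: desc e j']) ->
  forall i s s', path e i s -> path e i s' -> last i s = last i s' -> s = s'.
Proof.
move=> disj i s; elim: s i => [|x s IHs] i [|y s'] //=.
- move=> _ /andP[eiy ps'] iE; have /negP[] := acyclic_edge eiy.
  by apply/connectP; exists s'.
- move=> /andP[eix ps] _ iE; have /negP[] := acyclic_edge eix.
  by apply/connectP; exists s.
move=> /andP[eix ps] /andP[eiy ps'] lastE.
have [xy|xy] := eqVneq x y.
  by rewrite -xy in ps' lastE *; rewrite (IHs x s').
have /disjoint_setI0/setP/(_ (last x s)) := disj _ _ _ eix eiy xy.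
rewrite in_setI !in_subtree in_set0.
by rewrite {2}lastE; case/andP; split; apply/connectP; [exists s|exists s'].
Qed.

End DagTheory.

Theorem proposition1 (R : realType) (b N d : nat) (e : rel 'I_N.+1)
    (a : 'I_N.+1 -> 'rV[R]_d) (theta : nat -> R)
    (He : hierarchy e b ord0)
    (a_neq0 : forall i : 'I_N.+1, i != ord0 -> a i != 0)
    (theta_ge0 : forall l : nat, (1 <= l <= max_lev e)%N -> 0 <= theta l)
    (containment : forall i j : 'I_N.+1, i != ord0 -> j \in desc e i ->
       angle (a i) (a j) <= theta (lev e i))
    (separation : forall i j j' : 'I_N.+1,
       j \in chi e i -> j' \in chi e i -> j != j' ->
       angle (a j) (a j') > theta (lev e j) + theta (lev e j')) :
  (forall i j j' : 'I_N.+1,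
     j \in chi e i -> j' \in chi e i -> j != j' ->
     [disjoint j |: desc e j & j' |: desc e j']) /\
  (forall k : 'I_N.+1, k != ord0 -> exists! p : 'I_N.+1, k \in chi e p).
Proof.
have [dag reach _] := He.
have root_connect i : connect e ord0 i.
  by have [->|/reach] := eqVneq i ord0; first exact: connect0.
(* An edge followed by a path to the root would close a cycle, because the root reaches [i]. *)
have subtree_neq0 i j k : e i j -> connect e j k -> k != ord0.
  move=> eij cjk; apply/eqP => k0; have /negP[] := acyclic_edge dag eij.
  by apply: connect_trans (root_connect i); rewrite -k0.
have theta_lev_ge0 j : j != ord0 -> 0 <= theta (lev e j).
  move=> j0; apply: theta_ge0; rewrite (leq_bigmax j) andbT card_gt0.
  (* The root is an ancestor of [j], so the level is at least 1. *)
  by apply/set0Pn; exists ord0; rewrite inE eq_sym j0 root_connect.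
have disj i j j' : e i j -> e i j' -> j != j' ->
    [disjoint j |: desc e j & j' |: desc e j'].
  move=> eij eij' jj'; rewrite -setI_eq0; apply/eqP/setP => k.
  rewrite in_set0 in_setI !in_subtree; apply/negP => /andP[cjk cj'k].
  have j0 := subtree_neq0 _ _ _ eij (connect0 e j).
  have j'0 := subtree_neq0 _ _ _ eij' (connect0 e j').
  have k0 := subtree_neq0 _ _ _ eij cjk.
  have := separation i j j'; rewrite !inE => /(_ eij eij' jj').
  apply/negP; rewrite -leNgt.
  (* [desc] excludes the node itself, so containment says nothing about a cone and its own axis. If
     [k] is one of the siblings, it descends from the other: one containment bound suffices, and the
     remaining half-angle is nonnegative. *)
  have [jk|jk] := eqVneq k j.
    rewrite angleC -[leLHS]add0r lerD ?theta_lev_ge0 // containment //.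
    by rewrite inE jj' -jk.
  have [j'k|j'k] := eqVneq k j'.
    rewrite -[leLHS]addr0 lerD ?theta_lev_ge0 // containment //.
    by rewrite inE eq_sym jj' -j'k.
  apply: le_trans (angle_triangle (a_neq0 _ j0) (a_neq0 _ k0) (a_neq0 _ j'0)) _.
  by rewrite (angleC (a k)) lerD // containment // inE ?jk ?j'k.
split=> [i j j'|k k0]; first by rewrite !inE; exact: disj.
have /connectP[s] := root_connect k.
case/lastP: s => [_ /= kE|s k']; first by rewrite kE eqxx in k0.
rewrite rcons_path last_rcons => /andP[ps epk] kE; rewrite -{k'}kE in epk.
exists (last ord0 s); split=> [|p]; rewrite inE // => ek.
have /connectP[s' ps' pE] := root_connect p.
(* Extending root paths to both parents by [k] gives two paths from the root to [k]; their equality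
   forces the parents, as last nodes of the prefixes, to agree. *)
have /rcons_inj[->//] : rcons s k = rcons s' k.
apply: (acyclic_path_uniq dag disj (i := ord0)); rewrite ?rcons_path ?last_rcons //.
  by rewrite ps.
by rewrite ps' -pE.
Qed.
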